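(* Let $m\ge 2$ be even and let $\mathcal{X}$ be the $2^m$-QAM constellation, i.e. the Cartesian product of two $2^{m/2}$-PAM constellations (in-phase and quadrature), labeled by the binary reflected Gray mapping (the Cartesian product of binary reflected Gray mappings of the two PAM components), with $b_j(x)$ the $j$-th label bit of $x$. Consider the complex AWGN channel $Y=\sqrt{\mathsf{snr}}\,X+Z$, with $Z$ a zero-mean unit-variance circularly symmetric complex Gaussian. For bit distributions $P_{B_1},\dots,P_{B_m}$ on $\{0,1\}$, let the symbol $X$ have distribution $\prod_{j=1}^mP_{B_j}(b_j(x))$ on the points of the constellation, normalized (translated and scaled) so that $\mathbb{E}[X]=0$ and $\mathbb{E}[|X|^2]=1$. Define the shaped BICM capacity $$C_{\rm bicm}(\mathsf{snr})=\sup_{P_{B_1},\dots,P_{B_m}}\sum_{j=1}^m I(B_j;Y)$$ (mutual informations in nats). Then, as $\mathsf{snr}\to0$, $$C_{\rm bicm}(\mathsf{snr})=c_1\,\mathsf{snr}+c_2\,\mathsf{snr}^2+o(\mathsf{snr}^2)\quad\text{with } c_1=1,\ c_2=-\tfrac12,$$ i.e. BICM with shaping over QAM with binary reflected Gray mapping is first- and second-order optimal in the wideband regime.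
   Context: The binary reflected Gray mapping for $k$ bits is built recursively from that for $k-1$ bits by prefixing 0 to the list of $(k-1)$-bit labels and prefixing 1 to the same list in reverse order. A scheme with rate expansion $R(\mathsf{snr})=c_1\mathsf{snr}+c_2\mathsf{snr}^2+o(\mathsf{snr}^2)$ is called first- and second-order optimal if $c_1=1$ and $c_2=-1/2$ (the coefficients of the Gaussian channel capacity $\log(1+\mathsf{snr})$). *)

(* Defs.v *)
From HB Require Import structures.
From mathcomp Require Import all_boot all_order all_algebra.
From mathcomp Require Import all_classical all_reals all_analysis.
Set Implicit Arguments. Unset Strict Implicit. Unset Printing Implicit Defensive.
Import Order.TTheory GRing.Theory Num.Theory.
Import numFieldNormedType.Exports.
Local Open Scope classical_set_scope.
Local Open Scope ring_scope.

Fixpoint brgc (k : nat) : seq (seq bool) :=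
  if k is k'.+1 then
    [seq false :: w | w <- brgc k'] ++ [seq true :: w | w <- rev (brgc k')]
  else [:: [::]].

Definition pam_size (m : nat) : nat := 2 ^ m./2.

Definition qam_point (m : nat) : finType :=
  ('I_(pam_size m) * 'I_(pam_size m))%type.

Definition qam_label (m : nat) (x : qam_point m) : seq bool :=
  nth [::] (brgc m./2) x.1 ++ nth [::] (brgc m./2) x.2.

Definition qam_bit (m : nat) (x : qam_point m) (j : nat) : bool :=
  nth false (qam_label x) j.

Definition pam_amp (R : realType) (M : nat) (i : 'I_M) : R :=
  2 * i%:R - (M%:R - 1).

Definition bit_prob (R : realType) (p : nat -> R) (j : nat) (b : bool) : R :=
  if b then p j else 1 - p j.

Definition sym_prob (R : realType) (m : nat) (p : nat -> R) (x : qam_point m) : R :=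
  \prod_(j < m) bit_prob p j (qam_bit x j).

Definition raw_re (R : realType) (m : nat) (x : qam_point m) : R := pam_amp R x.1.
Definition raw_im (R : realType) (m : nat) (x : qam_point m) : R := pam_amp R x.2.

Definition mean_re (R : realType) (m : nat) (p : nat -> R) : R :=
  \sum_(x : qam_point m) sym_prob p x * raw_re R x.
Definition mean_im (R : realType) (m : nat) (p : nat -> R) : R :=
  \sum_(x : qam_point m) sym_prob p x * raw_im R x.

Definition raw_var (R : realType) (m : nat) (p : nat -> R) : R :=
  \sum_(x : qam_point m) sym_prob p x *
     ((raw_re R x - mean_re m p) ^+ 2 + (raw_im R x - mean_im m p) ^+ 2).

(* scaling making E|X|^2 = 1 (the variance is 0 only for a point mass, in which
   case every bit is deterministic and all mutual informations vanish anyway) *)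
Definition scale (R : realType) (m : nat) (p : nat -> R) : R :=
  if 0 < raw_var m p then (Num.sqrt (raw_var m p))^-1 else 1.

Definition pt (R : realType) (m : nat) (p : nat -> R) (x : qam_point m) : R * R :=
  ((raw_re R x - mean_re m p) * scale m p, (raw_im R x - mean_im m p) * scale m p).

(* density of Y = sqrt(snr) x + Z, Z ~ CN(0,1), at y = (Re y, Im y) *)
Definition awgn_density (R : realType) (snr : R) (x y : R * R) : R :=
  pi^-1 * expR (- ((y.1 - Num.sqrt snr * x.1) ^+ 2 + (y.2 - Num.sqrt snr * x.2) ^+ 2)).

Definition joint_density (R : realType) (m : nat) (p : nat -> R) (snr : R)
    (j : nat) (b : bool) (y : R * R) : R :=
  \sum_(x : qam_point m | qam_bit x j == b) sym_prob p x * awgn_density snr (pt p x) y.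

Definition out_density (R : realType) (m : nat) (p : nat -> R) (snr : R) (y : R * R) : R :=
  \sum_(x : qam_point m) sym_prob p x * awgn_density snr (pt p x) y.

Definition leb2 (R : realType) := ((@lebesgue_measure R) \x (@lebesgue_measure R))%E.

(* I(B_j ; Y) in nats (convention 0 ln(0/..) = 0, as ln 0 = 0 and 0 * _ = 0) *)
Definition bit_mi (R : realType) (m : nat) (p : nat -> R) (snr : R) (j : nat) : R :=
  Rintegral (@leb2 R) setT (fun y : R * R =>
    \sum_(b : bool) joint_density m p snr j b y *
       ln (joint_density m p snr j b y / (bit_prob p j b * out_density m p snr y))).

Definition bicm_rate (R : realType) (m : nat) (p : nat -> R) (snr : R) : R :=
  \sum_(j < m) bit_mi m p snr j.

Definition C_bicm (R : realType) (m : nat) (snr : R) : R :=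
  sup [set r : R | exists p : nat -> R,
         (forall j, (j < m)%N -> 0 <= p j <= 1) /\ r = bicm_rate m p snr].

(* Main.v *)
(* Upper bound: the label bits are independent, so the sum of the I(B_j; Y) is at
   most I(X; Y), which is at most ln (1 + snr) by comparing the output law with a
   centered complex Gaussian of variance 1 + snr. Both steps are Gibbs'
   inequalities and hold pointwise in y. A log-likelihood ratio W is replaced
   there by (e^(tW) - 1) / t, t > 0, so that only integrals of exponentials of
   quadratic polynomials occur; t -> 0 gives the bound, uniformly in the bit
   distributions.
   Lower bound: make the leading bit of each PAM label uniform and all the other
   bits deterministic. This leaves QPSK, i.e. two BPSK channels, whose mutual
   information is bounded below by replacing ln (1 + v) with its Taylor
   polynomial of degree 5; its moments are polynomials in e^(4 snr). *)
Require Import Defs.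
From HB Require Import structures.
From mathcomp Require Import all_boot all_order all_algebra.
From mathcomp Require Import all_classical all_reals all_analysis.
From mathcomp Require Import measurable_realfun zify ring lra.
Set Implicit Arguments. Unset Strict Implicit. Unset Printing Implicit Defensive.
Import Order.TTheory GRing.Theory Num.Theory.
Import numFieldNormedType.Exports.
Local Open Scope ring_scope.

(** * Gaussian integrals on the line and on the plane *)

Section GaussianIntegrals.
Context {R : realType}.

(** Completing the square: up to the constant on the right, the integrand is the normal density of
    mean b / (2A) and variance 1 / (2A). *)
Lemma integral_expR_quad (A b : R) : 0 < A ->
  (\int[@lebesgue_measure R]_x (expR (- (A * x ^+ 2) + b * x))%:E =
   (Num.sqrt (pi / A) * expR (b ^+ 2 / (4 * A)))%:E)%E.
Proof.
move=> A0.
have s0 : 0 < (Num.sqrt (2 * A))^-1 by rewrite invr_gt0 sqrtr_gt0 mulr_gt0.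
have s2 : ((Num.sqrt (2 * A))^-1) ^+ 2 = (2 * A)^-1.
  by rewrite exprVn sqr_sqrtr// mulr_ge0// ltW.
transitivity (\int[@lebesgue_measure R]_x
  ((Num.sqrt (pi / A) * expR (b ^+ 2 / (4 * A)))%:E *
   (normal_pdf (b / (2 * A)) (Num.sqrt (2 * A))^-1 x)%:E))%E; last first.
  by rewrite integralZl//= ?integral_normal_pdf ?mule1//; exact: integrable_normal_pdf.
apply: eq_integral => x _; rewrite -EFinM normal_pdfE ?gt_eqF//.
congr (_%:E); rewrite /normal_peak /normal_fun s2.
have -> : (2 * A)^-1 * pi *+ 2 = pi / A :> R by field; rewrite gt_eqF.
rewrite [RHS]mulrACA divff ?mul1r; last first.
  by rewrite gt_eqF// sqrtr_gt0 divr_gt0// pi_gt0.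
rewrite -expRD; congr expR; field; rewrite gt_eqF//=.
Qed.

(** [Rintegral] is total, so integrability is carried along with the value; linearity and
    monotonicity then need no side conditions. *)
Definition is_Rint (f : R * R -> R) (v : R) :=
  (@leb2 R).-integrable setT (EFin \o f) /\ Rintegral (@leb2 R) setT f = v.

(** Common form of the Gaussian densities and of all their exponential tilts that are integrated
    below. *)
Definition expq (A b1 b2 k : R) (y : R * R) : R :=
  expR (- (A * (y.1 ^+ 2 + y.2 ^+ 2)) + b1 * y.1 + b2 * y.2 + k).

Lemma measurable_expq (A b1 b2 k : R) : measurable_fun setT (expq A b1 b2 k).
Proof.
have m1 : measurable_fun setT (fst : R * R -> R) by exact: measurable_fst.
have m2 : measurable_fun setT (snd : R * R -> R) by exact: measurable_snd.
apply: measurableT_comp => //.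
apply: measurable_funD => //; apply: measurable_funD; last exact: measurable_funM.
apply: measurable_funD; last exact: measurable_funM.
apply: measurableT_comp => //; apply: measurable_funM => //.
by apply: measurable_funD; exact: measurable_funX.
Qed.

Lemma is_Rint_expq (A b1 b2 k : R) : 0 < A ->
  is_Rint (expq A b1 b2 k) (pi / A * expR ((b1 ^+ 2 + b2 ^+ 2) / (4 * A) + k)).
Proof.
move=> A0.
have int : (\int[@leb2 R]_y (expq A b1 b2 k y)%:E =
    (pi / A * expR ((b1 ^+ 2 + b2 ^+ 2) / (4 * A) + k))%:E)%E.
  rewrite /leb2 fubini_tonelli1//=; last 2 first.
  - by apply/measurable_EFinP; exact: measurable_expq.
  - by move=> y; rewrite lee_fin expR_ge0.
  rewrite /fubini_F /=.
  transitivity (\int[@lebesgue_measure R]_x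
     ((Num.sqrt (pi / A) * expR (b2 ^+ 2 / (4 * A) + k))%:E *
      (expR (- (A * x ^+ 2) + b1 * x))%:E))%E.
    apply: eq_integral => x _.
    transitivity (\int[@lebesgue_measure R]_y
       ((expR (- (A * x ^+ 2) + b1 * x + k))%:E *
        (expR (- (A * y ^+ 2) + b2 * y))%:E))%E.
      apply: eq_integral => y _; rewrite -EFinM -expRD /expq /=.
      by congr (_%:E); congr expR; ring.
    rewrite ge0_integralZl//=.
    - rewrite integral_expR_quad// -!EFinM; congr (_%:E).
      rewrite !expRD; ring.
    - apply/measurable_EFinP; apply: measurableT_comp => //.
      apply: measurable_funD; last exact: measurable_funM.
      by apply: measurableT_comp => //; apply: measurable_funM.
  rewrite ge0_integralZl//=.
  - rewrite integral_expR_quad// -!EFinM; congr (_%:E).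
    rewrite mulrACA -expr2 sqr_sqrtr ?divr_ge0 ?pi_ge0 ?ltW// -expRD.
    by congr (_ * expR _); field; rewrite gt_eqF.
  - apply/measurable_EFinP; apply: measurableT_comp => //.
    apply: measurable_funD; last exact: measurable_funM.
    by apply: measurableT_comp => //; apply: measurable_funM.
split; last by rewrite /Rintegral int.
apply/integrableP; split; first by apply/measurable_EFinP; exact: measurable_expq.
under eq_integral do rewrite /= ger0_norm ?expR_ge0//.
by rewrite int ltry.
Qed.

Lemma eq_is_Rint (f g : R * R -> R) (v w : R) :
  f =1 g -> v = w -> is_Rint f v -> is_Rint g w.
Proof. by move=> /funext -> ->. Qed.

Lemma is_RintZ (c : R) (f : R * R -> R) (v : R) :
  is_Rint f v -> is_Rint (fun y => c * f y) (c * v).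
Proof.
move=> [fi <-]; split; last by rewrite RintegralZl.
rewrite (_ : _ \o _ = (fun y => c%:E * (EFin \o f) y)%E); first exact: integrableZl.
by apply/funext => y /=; rewrite EFinM.
Qed.

Lemma is_RintD (f g : R * R -> R) (v w : R) :
  is_Rint f v -> is_Rint g w -> is_Rint (fun y => f y + g y) (v + w).
Proof.
move=> [fi <-] [gi <-]; split; last by rewrite RintegralD.
rewrite (_ : _ \o _ = (EFin \o f) \+ (EFin \o g))%E; first exact: integrableD.
by apply/funext => y /=; rewrite EFinD.
Qed.

Lemma is_Rint0 : is_Rint (fun=> 0) 0.
Proof.
split; first exact: integrable0.
by rewrite /Rintegral integral0.
Qed.

Lemma is_Rint_sum {I : Type} (s : seq I) (P : pred I) (f : I -> R * R -> R) (v : I -> R) :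
  (forall i, P i -> is_Rint (f i) (v i)) ->
  is_Rint (fun y => \sum_(i <- s | P i) f i y) (\sum_(i <- s | P i) v i).
Proof.
move=> h; elim: s => [|i s ih].
  by apply: eq_is_Rint is_Rint0; [move=> y|]; rewrite big_nil.
rewrite big_cons; have [Pi|Pi] := boolP (P i).
  apply: eq_is_Rint (is_RintD (h _ Pi) ih) => // y.
  by rewrite big_cons Pi.
by apply: eq_is_Rint ih => // y; rewrite big_cons (negbTE Pi).
Qed.

(** Meant for the integrand of the mutual information, which has no closed-form integral but a
    majorant that has one. *)
Lemma is_Rint_dominated (f g : R * R -> R) (v : R) :
  measurable_fun setT f -> (forall y, 0 <= f y <= g y) -> is_Rint g v ->
  is_Rint f (Rintegral (@leb2 R) setT f).
Proof.
move=> mf fg [gi _]; split=> //.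
apply: le_integrable gi => //; first exact/measurable_EFinP.
move=> y _; rewrite /= lee_fin; have /andP[f0 fgy] := fg y.
by rewrite !ger0_norm// (le_trans f0).
Qed.

Lemma le_is_Rint (f g : R * R -> R) (v w : R) :
  (forall y, f y <= g y) -> is_Rint f v -> is_Rint g w -> v <= w.
Proof. by move=> fg [fi <-] [gi <-]; apply: le_Rintegral. Qed.

End GaussianIntegrals.

(** * Binary reflected Gray labels of PAM and QAM points *)

Section GrayLabels.

Lemma size_brgc k : size (brgc k) = (2 ^ k)%N.
Proof.
elim: k => //= k ih.
by rewrite size_cat !size_map size_rev ih expnS mul2n addnn.
Qed.

Lemma size_brgc_word k w : w \in brgc k -> size w = k.
Proof.
elim: k w => [w|k ih w] /=; first by rewrite inE => /eqP ->.
rewrite mem_cat => /orP[] /mapP[v vk ->] /=; rewrite ih//.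
by rewrite mem_rev in vk.
Qed.

Lemma uniq_brgc k : uniq (brgc k).
Proof.
elim: k => //= k ih.
rewrite cat_uniq !map_inj_uniq ?rev_uniq ?ih; try by move=> ? ? [].
rewrite /= andbT -all_predC; apply/allP => w /mapP[v _ ->] /=.
by apply/mapP => -[].
Qed.

Lemma nth_brgc_first k : nth [::] (brgc k) 0 = nseq k false.
Proof.
elim: k => //= k ih.
by rewrite nth_cat size_map size_brgc expn_gt0/= (nth_map [::]) ?size_brgc ?expn_gt0// ih.
Qed.

(** Reflection puts the copy of the first word last, so the two extreme words differ in the leading
    bit only. *)
Lemma nth_brgc_last k :
  nth [::] (brgc k.+1) (2 ^ k.+1).-1 = true :: nseq k false.
Proof.
have k0 : (0 < 2 ^ k)%N by rewrite expn_gt0.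
have -> : (2 ^ k.+1).-1 = (2 ^ k + (2 ^ k).-1)%N by rewrite expnS; lia.
rewrite /= nth_cat size_map size_brgc ltnNge leq_addr/= addKn.
rewrite (nth_map [::]) ?size_rev ?size_brgc; last by lia.
rewrite nth_rev ?size_brgc; last by lia.
by rewrite prednK// subnn nth_brgc_first.
Qed.

Definition pam_label m (i : 'I_(pam_size m)) : seq bool := nth [::] (brgc m./2) i.

Lemma size_pam_label m (i : 'I_(pam_size m)) : size (pam_label i) = m./2.
Proof. by apply/size_brgc_word/mem_nth; rewrite size_brgc. Qed.

Lemma pam_label_inj m : injective (@pam_label m).
Proof.
move=> i i' /eqP; rewrite nth_uniq ?size_brgc ?uniq_brgc ?ltn_ord//.
by move=> /eqP; exact: val_inj.
Qed.

Lemma qam_bitE m (x : qam_point m) (j : nat) : qam_bit x j =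
  if (j < m./2)%N then nth false (pam_label x.1) j
  else nth false (pam_label x.2) (j - m./2).
Proof. by rewrite /qam_bit /qam_label nth_cat size_pam_label. Qed.

Variable R : realType.

Lemma prod_qam_bit m (F : nat -> bool -> R) (x : qam_point m) : ~~ odd m ->
  \prod_(j < m) F j (qam_bit x j) =
  (\prod_(j < m./2) F j (nth false (pam_label x.1) j)) *
  (\prod_(j < m./2) F (m./2 + j)%N (nth false (pam_label x.2) j)).
Proof.
move=> em; rewrite -(big_mkord xpredT (fun j => F j (qam_bit x j))).
have mE : m = (m./2 + m./2)%N by rewrite addnn even_halfK.
rewrite (@big_cat_nat _ _ _ m./2)//=; last by rewrite {2}mE leq_addr.
rewrite big_mkord; congr (_ * _).
  by apply: eq_bigr => j _; rewrite qam_bitE ltn_ord.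
rewrite -{1}(add0n m./2) big_addn {1}mE addnK big_mkord.
by apply: eq_bigr => j _; rewrite qam_bitE ltnNge leq_addl/= addnK addnC.
Qed.

(** Gray words are pairwise distinct, and there are 2^m points and 2^m bit vectors. *)
Lemma qam_bits_bij m : ~~ odd m ->
  bijective (fun x : qam_point m => [ffun j : 'I_m => qam_bit x j]).
Proof.
move=> em; have mE : m = (m./2 + m./2)%N by rewrite addnn even_halfK.
apply: inj_card_bij; last first.
  rewrite card_ffun card_bool card_ord card_prod !card_ord.
  by rewrite /pam_size -expnD -mE.
move=> [i1 i2] [j1 j2] /ffunP bE.
have b1 j : (j < m./2)%N -> nth false (pam_label i1) j = nth false (pam_label j1) j.
  move=> jm; have jm' : (j < m)%N by rewrite mE ltn_addl.
  by have := bE (Ordinal jm'); rewrite !ffunE !qam_bitE /= jm.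
have b2 j : (j < m./2)%N -> nth false (pam_label i2) j = nth false (pam_label j2) j.
  move=> jm; have jm' : (m./2 + j < m)%N by rewrite {2}mE ltn_add2l.
  by have := bE (Ordinal jm'); rewrite !ffunE !qam_bitE /= ltnNge leq_addr/= addKn.
by congr pair; apply: pam_label_inj; apply: (@eq_from_nth _ false);
  rewrite !size_pam_label.
Qed.

(** Every bit vector labels exactly one point, so the right side expands into the left. This gives
    total mass one both to [sym_prob] and to a product of bit posteriors. *)
Lemma sum_qam_label m (F : nat -> bool -> R) : ~~ odd m ->
  \sum_(x : qam_point m) \prod_(j < m) F j (qam_bit x j) =
  \prod_(j < m) (F j true + F j false).
Proof.
move=> em; transitivity (\prod_(j < m) \sum_(b : bool) F j b); last first.
  by apply: eq_bigr => j _; rewrite big_bool.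
rewrite bigA_distr_bigA /= (reindex _ (onW_bij _ (qam_bits_bij em))) /=.
by apply: eq_bigr => x _; apply: eq_bigr => j _; rewrite ffunE.
Qed.

End GrayLabels.

(** * The QPSK input supported on the four corners *)

Section CornerInput.
Variables (R : realType) (m : nat).
Hypotheses (m2 : (2 <= m)%N) (em : ~~ odd m).

(* Only the two leading label bits are random: by reflection of the Gray code,
   the support then consists of the four corners, i.e. of a QPSK constellation. *)
Definition corner_prob (j : nat) : R :=
  if (j == 0)%N || (j == m./2) then 2^-1 else 0.

Let M0 : (0 < pam_size m)%N. Proof. by rewrite expn_gt0. Qed.
Let k0 : (0 < m./2)%N. Proof. by rewrite half_gt0. Qed.
Let M1 : (1 < pam_size m)%N. Proof. by rewrite -{1}(expn0 2) ltn_exp2l. Qed.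

Definition pam_corner (b : bool) : 'I_(pam_size m) :=
  insubd (Ordinal M0) (if b then (pam_size m).-1 else 0%N).

Definition qam_corner (b1 b2 : bool) : qam_point m := (pam_corner b1, pam_corner b2).

Lemma val_pam_corner b : pam_corner b = (if b then (pam_size m).-1 else 0%N) :> nat.
Proof. by rewrite /pam_corner val_insubd; case: b; rewrite ?M0// prednK// leqnn. Qed.

Lemma pam_label_corner b : pam_label (pam_corner b) = b :: nseq m./2.-1 false.
Proof.
rewrite /pam_label val_pam_corner /pam_size; case: m./2 k0 => // k _.
by case: b; rewrite ?nth_brgc_last ?nth_brgc_first.
Qed.

(** One law serves both components, since [corner_prob] agrees on j and m./2 + j for j < m./2. *)
Definition pam_prob (i : 'I_(pam_size m)) : R :=
  \prod_(j < m./2) bit_prob corner_prob j (nth false (pam_label i) j).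

Lemma pam_prob_corner b : pam_prob (pam_corner b) = 2^-1.
Proof.
rewrite /pam_prob pam_label_corner (bigD1 (Ordinal k0))//= big1 => [|j jn0].
  by rewrite mulr1 /bit_prob /corner_prob/=; case: b; lra.
have {}jn0 : (j : nat) != 0%N by apply: contraNneq jn0 => j0; apply/eqP/val_inj.
rewrite /bit_prob /corner_prob (negbTE jn0)/= ltn_eqF ?ltn_ord//.
by case: (j : nat) jn0 => //= i _; rewrite nth_nseq if_same subr0.
Qed.

(** By contraposition: a bit set after the leading one contributes a factor 0, so a label of nonzero
    mass is a corner label, and labels determine points. *)
Lemma pam_prob_eq0 i : (forall b, i != pam_corner b) -> pam_prob i = 0.
Proof.
move=> ni; apply/eqP/negP => /negP hi.
suff : i = pam_corner (nth false (pam_label i) 0) by apply/eqP.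
apply: pam_label_inj; rewrite pam_label_corner.
apply: (@eq_from_nth _ false); rewrite size_pam_label/= ?size_nseq ?prednK// => -[|j] jk//=.
rewrite nth_nseq if_same; apply: contraNF hi => bj.
rewrite /pam_prob (bigD1 (Ordinal jk))//= /bit_prob bj /corner_prob/= ltn_eqF//.
by rewrite mul0r.
Qed.

Lemma sum_pam_prob (G : 'I_(pam_size m) -> R) :
  \sum_i pam_prob i * G i = 2^-1 * \sum_(b : bool) G (pam_corner b).
Proof.
have ne : pam_corner true != pam_corner false.
  by apply/eqP => /(congr1 (@nat_of_ord _)); rewrite !val_pam_corner; move: M1; lia.
rewrite (bigD1 (pam_corner true))//= (bigD1 (pam_corner false)) 1?eq_sym//=.
rewrite big1 => [|i /andP[it if_]]; last by rewrite pam_prob_eq0 ?mul0r// => -[].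
by rewrite !pam_prob_corner big_bool addr0 mulrDr.
Qed.

Lemma sym_prob_corner x : sym_prob corner_prob x = pam_prob x.1 * pam_prob x.2 :> R.
Proof.
rewrite /sym_prob (prod_qam_bit (bit_prob corner_prob))//; congr (_ * _).
apply: eq_bigr => j _; rewrite /bit_prob /corner_prob.
have -> : (m./2 + j == m./2)%N = (j == 0 :> nat)%N by lia.
by rewrite addn_eq0 (gtn_eqF k0)/= (ltn_eqF (ltn_ord j)) orbF.
Qed.

Lemma sum_sym_prob_corner (G : qam_point m -> R) :
  \sum_x sym_prob corner_prob x * G x =
  4^-1 * \sum_(b1 : bool) \sum_(b2 : bool) G (qam_corner b1 b2).
Proof.
transitivity (\sum_(i1 : 'I_(pam_size m)) \sum_(i2 : 'I_(pam_size m))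
    pam_prob i1 * (pam_prob i2 * G (i1, i2))).
  by rewrite pair_bigA; apply: eq_bigr => -[i1 i2] _; rewrite sym_prob_corner mulrA.
under eq_bigr do rewrite -mulr_sumr sum_pam_prob.
rewrite sum_pam_prob -mulr_sumr mulrA; congr (_ * _).
by rewrite -invfM -natrM.
Qed.

Let A : R := (pam_size m)%:R - 1.
Let A0 : 0 < A. Proof. by rewrite subr_gt0 ltr1n. Qed.

Definition bsign (b : bool) : R := if b then 1 else -1.

Lemma pam_amp_corner b : pam_amp R (pam_corner b) = bsign b * A.
Proof.
rewrite /pam_amp val_pam_corner /A /bsign.
by case: b; rewrite -?subn1 ?natrB//; ring.
Qed.

Lemma mean_re_corner : mean_re m corner_prob = 0 :> R.
Proof.
rewrite /mean_re sum_sym_prob_corner !big_bool /raw_re /= !pam_amp_corner /bsign.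
by ring.
Qed.

Lemma mean_im_corner : mean_im m corner_prob = 0 :> R.
Proof.
rewrite /mean_im sum_sym_prob_corner !big_bool /raw_im /= !pam_amp_corner /bsign.
by ring.
Qed.

Lemma raw_var_corner : raw_var m corner_prob = 2 * A ^+ 2 :> R.
Proof.
rewrite /raw_var sum_sym_prob_corner !big_bool mean_re_corner mean_im_corner.
rewrite /raw_re /raw_im /= !pam_amp_corner /bsign.
by field.
Qed.

(** The outer amplitude [A] cancels in the normalization, which leaves the same unit-energy QPSK for
    every m. *)
Lemma pt_corner b1 b2 : pt corner_prob (qam_corner b1 b2) =
  (bsign b1 / Num.sqrt 2, bsign b2 / Num.sqrt 2).
Proof.
rewrite /pt /scale raw_var_corner mean_re_corner mean_im_corner.
rewrite mulr_gt0 ?exprn_gt0// sqrtrM// sqrtr_sqr gtr0_norm//.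
rewrite /raw_re /raw_im !pam_amp_corner !subr0.
by congr pair; field; rewrite ?gt_eqF ?sqrtr_gt0.
Qed.

Lemma qam_bit_corner0 b1 b2 : qam_bit (qam_corner b1 b2) 0 = b1.
Proof. by rewrite qam_bitE k0 pam_label_corner. Qed.

Lemma qam_bit_corner_half b1 b2 : qam_bit (qam_corner b1 b2) m./2 = b2.
Proof. by rewrite qam_bitE ltnn subnn pam_label_corner. Qed.

End CornerInput.

(** * Gibbs' inequality, measurability, and one-sided derivatives at 0 *)

Section AnalyticTools.
(** The first lemma is the pointwise form of Gibbs' inequality, from ln v <= v - 1 at v = b / a. Its
    last hypothesis is absolute continuity: for b = 0 the right side is 0 by the conventions on
    division and [ln]. *)
Context {R : realType}.

Lemma subr_le_mul_ln (a b : R) : 0 <= a -> 0 <= b -> (b = 0 -> a = 0) ->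
  a - b <= a * ln (a / b).
Proof.
rewrite le_eqVlt => /predU1P[<- b0 _|a0]; first by rewrite mul0r sub0r oppr_le0.
rewrite le_eqVlt => /predU1P[<- /(_ erefl) a0'|b0 _]; first by rewrite a0' ltxx in a0.
have ab0 : 0 < a / b by rewrite divr_gt0.
have h : ln (b / a) <= b / a - 1.
  rewrite -{1}(subrKC 1 (b / a)) le_ln1Dx// ltrBrDr addNr divr_gt0//.
have -> : a - b = a * (1 - b / a) by field; rewrite gt_eqF.
rewrite ler_pM2l// -[a / b]invrK invf_div lnV ?posrE ?divr_gt0//; lra.
Qed.

Lemma ln_prod (I : Type) (r : seq I) (F : I -> R) : (forall i, 0 < F i) ->
  ln (\prod_(i <- r) F i) = \sum_(i <- r) ln (F i).
Proof.
move=> F0; elim: r => [|i r ih]; first by rewrite !big_nil ln1.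
by rewrite !big_cons lnM ?ih// posrE// prodr_gt0.
Qed.

(** On nonnegative reals the inverse is the power of exponent -1, also at 0, where both are 0. *)
Lemma measurable_funV d (T : measurableType d) (D : set T) (f : T -> R) :
  (forall x, 0 <= f x) -> measurable_fun D f -> measurable_fun D (fun x => (f x)^-1).
Proof.
move=> f0 mf; rewrite (_ : (fun _ => _) = (@powR R ^~ (-1)) \o f).
  by apply: measurableT_comp => //; exact: measurable_powR.
by apply/funext => x /=; rewrite powR_inv1.
Qed.

(** Lets t tend to 0 after integration, so that no limit has to be exchanged with an integral. *)
Lemma le_sum_derive0_right (I : finType) (c l : I -> R) (F : I -> R -> R) (r : R) :
  (forall i, is_derive (0 : R) (1 : R) (F i) (l i)) ->
  (forall t, 0 < t -> r <= \sum_i c i * (t^-1 * (F i t - F i 0))) ->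
  r <= \sum_i c i * l i.
Proof.
move=> dF h.
have cF : (\sum_i c i * (t^-1 * (F i t - F i 0)) @[t --> 0^'+] -->
    \sum_i c i * l i)%classic.
  apply: cvg_big => [|i _]; first exact: add_continuous.
  have cFi : (t^-1 * (F i t - F i 0) @[t --> 0^'+] --> l i)%classic.
    apply: cvg_dnbhs_at_right.
    have [dFi <-] := dF i.
    have : (t^-1 *: (F i (t *: 1 + 0) - F i 0) @[t --> 0^'] --> 'D_1 (F i) 0)%classic.
      exact: dFi.
    by under eq_cvg do rewrite addr0 [_ *: 1]mulr1.
  exact: (cvgM (cvg_cst _) cFi).
apply: (cvgr_to_ge cF); near=> t; exact: h.
Unshelve. all: by end_near. Qed.

(** For a = snr / (1 + snr) and l = ln (1 + snr), the derivative is the Kullback-Leibler divergence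
    of a unit-variance complex Gaussian with squared mean K from the centered one of variance 1 +
    snr. *)
Lemma is_derive0_renyi (a K l : R) :
  is_derive (0 : R) 1
    (fun t => (1 + a * t)^-1 *
       expR ((1 + t) ^+ 2 * K * (1 + a * t)^-1 - (1 + t) * K + t * l))
    (l - a + K * (1 - a)).
Proof.
have i0 : is_derive (0 : R) 1 (fun t : R => 1 + a * t) a.
  apply: is_derive_eq; rewrite /GRing.scale/=; ring.
have i1 : is_derive (0 : R) 1 (fun t : R => (1 + a * t)^-1) (- a).
  apply: is_derive_eq; first by apply: is_deriveV; rewrite mulr0 addr0 oner_eq0.
  by rewrite /GRing.scale/= mulr0 addr0 expr1n invr1 mulN1r.
have i2 : is_derive (0 : R) 1
    (fun t : R => (1 + t) ^+ 2 * K * (1 + a * t)^-1 - (1 + t) * K + t * l)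
    (l + K * (1 - a)).
  apply: is_derive_eq; rewrite /GRing.scale/= mulr0 addr0 invr1; ring.
have i3 := is_derive1_comp (is_derive_expR _) i2.
apply: is_derive_eq.
rewrite /GRing.scale/= mulr0 addr0 invr1 (_ : 1 ^+ 2 * K * 1 - _ + _ = 0); last by ring.
by rewrite expR0; ring.
Qed.

End AnalyticTools.

(** * Upper bound ln (1 + snr), uniform in the bit distributions *)

Section RateUpperBound.
Variables (R : realType) (m : nat) (p : nat -> R) (snr : R).
Hypotheses (em : ~~ odd m) (p01 : forall j, (j < m)%N -> 0 <= p j <= 1).

Lemma bit_prob_ge0 j b : (j < m)%N -> 0 <= bit_prob p j b.
Proof. by move=> /p01 /andP[p0 p1]; case: b; rewrite //= subr_ge0. Qed.

Lemma sym_prob_ge0 (x : qam_point m) : 0 <= sym_prob p x.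
Proof. by apply: prodr_ge0 => j _; rewrite bit_prob_ge0. Qed.

Lemma sum_sym_prob : \sum_(x : qam_point m) sym_prob p x = 1.
Proof. by rewrite sum_qam_label// big1// => j _; rewrite /= subrKC. Qed.

Lemma awgn_density_gt0 (x y : R * R) : 0 < awgn_density snr x y.
Proof. by rewrite mulr_gt0 ?expR_gt0// invr_gt0 pi_gt0. Qed.

Lemma joint_density_ge0 j b y : 0 <= joint_density m p snr j b y.
Proof.
by apply: sumr_ge0 => x _; rewrite mulr_ge0 ?sym_prob_ge0// ltW// awgn_density_gt0.
Qed.

Lemma out_density_gt0 y : 0 < out_density m p snr y.
Proof.
have P0 (x : qam_point m) : 0 <= sym_prob p x * awgn_density snr (pt p x) y.
  by rewrite mulr_ge0 ?sym_prob_ge0// ltW// awgn_density_gt0.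
rewrite lt_neqAle sumr_ge0 ?andbT => [|x _]; last exact: P0.
rewrite eq_sym psumr_eq0 => [|x _]; last exact: P0.
apply/negP => /allP h; have := sum_sym_prob.
rewrite big1 => [/eqP|x _]; first by rewrite eq_sym oner_eq0.
have := h x (mem_index_enum _).
by rewrite mulf_eq0 (gt_eqF (awgn_density_gt0 _ _)) orbF => /eqP.
Qed.

Lemma joint_density_sum j y :
  \sum_(b : bool) joint_density m p snr j b y = out_density m p snr y.
Proof.
by rewrite /joint_density /out_density [RHS](partition_big (fun x => qam_bit x j) xpredT).
Qed.

Lemma sym_prob_eq0 j (x : qam_point m) : (j < m)%N ->
  bit_prob p j (qam_bit x j) = 0 -> sym_prob p x = 0.
Proof. by move=> jm e; rewrite /sym_prob (bigD1 (Ordinal jm))//= e mul0r. Qed.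

Lemma joint_density_eq0 j b y : (j < m)%N ->
  bit_prob p j b = 0 -> joint_density m p snr j b y = 0.
Proof.
move=> jm e; apply: big1 => x /eqP xb.
by rewrite (@sym_prob_eq0 j)// ?mul0r// xb.
Qed.

(** The integrand of [bit_mi]: the output density at y times the divergence of the posterior of bit
    j from its prior. It is thus nonnegative at every y. *)
Definition bit_kl (j : nat) (y : R * R) : R :=
  \sum_(b : bool) joint_density m p snr j b y *
     ln (joint_density m p snr j b y / (bit_prob p j b * out_density m p snr y)).

Lemma bit_kl_ge0 j y : (j < m)%N -> 0 <= bit_kl j y.
Proof.
move=> jm.
have -> : 0 = \sum_(b : bool) (joint_density m p snr j b y -
    bit_prob p j b * out_density m p snr y).
  by rewrite sumrB joint_density_sum -mulr_suml big_bool /= subrKC mul1r subrr.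
apply: ler_sum => b _; apply: subr_le_mul_ln.
- exact: joint_density_ge0.
- by rewrite mulr_ge0 ?bit_prob_ge0// ltW// out_density_gt0.
- move=> /eqP; rewrite mulf_eq0 (gt_eqF (out_density_gt0 _)) orbF => /eqP.
  exact: joint_density_eq0.
Qed.

(* Gibbs' inequality twice at once: the posterior of the label bits is compared
   with the product of its marginals, and the output density with [g]. *)
Lemma sum_bit_kl_le (g t : R) (W : qam_point m -> R) (y : R * R) :
  0 < t -> (forall x, g = awgn_density snr (pt p x) y * expR (- W x)) ->
  \sum_(j < m) bit_kl j y <=
  \sum_x sym_prob p x * (t^-1 * (awgn_density snr (pt p x) y * expR (t * W x)
                                 - awgn_density snr (pt p x) y))
  + (g - out_density m p snr y).
Proof.
move=> t0 gE.
set f := fun x : qam_point m => awgn_density snr (pt p x) y.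
have f0 x : 0 < f x by exact: awgn_density_gt0.
set q := out_density m p snr y; have q0 : 0 < q by exact: out_density_gt0.
pose post j b := joint_density m p snr j b y / q.
pose r j b := joint_density m p snr j b y / (bit_prob p j b * q).
(* Both sides of the goal become sums over the symbols, to be compared term by term. *)
have -> : \sum_(j < m) bit_kl j y =
    \sum_x sym_prob p x * f x * \sum_(j < m) ln (r j (qam_bit x j)).
  under [RHS]eq_bigr do rewrite mulr_sumr.
  rewrite [RHS]exchange_big; apply: eq_bigr => j _.
  rewrite [RHS](partition_big (fun x => qam_bit x j) xpredT)//=.
  apply: eq_bigr => b _; rewrite {1}/joint_density mulr_suml; apply: eq_bigr => x /eqP xb.
  by rewrite xb.
(* The product of the bit posteriors is a probability on the labels, so its total mass is 1. *)
have -> : g - q = \sum_x ((\prod_(j < m) post j (qam_bit x j)) * g - sym_prob p x * f x).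
  rewrite sumrB -mulr_suml sum_qam_label// big1 ?mul1r// => j _.
  rewrite -mulrDl -[X in X / _](_ : \sum_(b : bool) joint_density m p snr j b y = _).
    by rewrite joint_density_sum divff// gt_eqF.
  by rewrite big_bool.
rewrite -big_split; apply: ler_sum => x _ /=.
have post0 : 0 <= \prod_(j < m) post j (qam_bit x j).
  by apply: prodr_ge0 => j _; rewrite divr_ge0 ?joint_density_ge0// ltW.
(* A symbol of mass 0 leaves only the nonnegative term with [g]; for the others all logarithms have
   positive arguments. *)
have := sym_prob_ge0 x; rewrite le_eqVlt => /predU1P[<-|P0].
  by rewrite !mul0r subr0 add0r mulr_ge0// (gE x) mulr_ge0 ?expR_ge0 ?ltW ?awgn_density_gt0.
have pb0 (j : 'I_m) : 0 < bit_prob p j (qam_bit x j).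
  rewrite lt_neqAle bit_prob_ge0// andbT eq_sym.
  by apply: contraTneq P0 => /sym_prob_eq0 ->//; rewrite ltxx.
have J0 (j : 'I_m) : 0 < joint_density m p snr j (qam_bit x j) y.
  apply: (@lt_le_trans _ _ (sym_prob p x * f x)); first by rewrite mulr_gt0.
  rewrite /joint_density (bigD1 x)//= lerDl; apply: sumr_ge0 => x' _.
  by rewrite mulr_ge0 ?sym_prob_ge0// ltW// awgn_density_gt0.
have r0 (j : 'I_m) : 0 < r j (qam_bit x j) by rewrite divr_gt0// mulr_gt0.
rewrite -ln_prod//; set rr := \prod_(j < m) r j _.
have rr0 : 0 < rr by rewrite prodr_gt0.
have postE : \prod_(j < m) post j (qam_bit x j) = sym_prob p x * rr.
  rewrite -big_split; apply: eq_bigr => j _ /=; rewrite /post /r.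
  by field; rewrite !gt_eqF.
(* Split ln rr as ln (rr e^(-W)) + W, then use ln v <= v - 1 on the first term and W <= (e^(tW) - 1)
   / t on the second. *)
have lnrr : ln rr <= rr * expR (- W x) - 1 + t^-1 * (expR (t * W x) - 1).
  have -> : ln rr = ln (rr * expR (- W x)) + W x.
    by rewrite lnM ?posrE ?expR_gt0// expRK subrK.
  apply: lerD.
    by rewrite -{1}(subrKC 1 (rr * _)) le_ln1Dx// ltrBrDr addNr mulr_gt0// expR_gt0.
  rewrite ler_pdivlMl// lerBrDl.
  exact: expR_ge1Dx.
rewrite postE (gE x) -/(f x).
apply: le_trans (ler_wpM2l _ lnrr) _; first by rewrite mulr_ge0// ltW.
rewrite le_eqVlt; apply/predU1P; left; ring.
Qed.

Lemma measurable_awgn_density (x : R * R) : measurable_fun setT (awgn_density snr x).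
Proof.
rewrite (_ : awgn_density snr x = (fun y => pi^-1 * expq 1 (2 * Num.sqrt snr * x.1)
   (2 * Num.sqrt snr * x.2)
   (- ((Num.sqrt snr * x.1) ^+ 2 + (Num.sqrt snr * x.2) ^+ 2)) y)).
  by apply: measurable_funM => //; exact: measurable_expq.
apply/funext => y; rewrite /awgn_density /expq; congr (_ * expR _); ring.
Qed.

Lemma measurable_bit_kl j : (j < m)%N -> measurable_fun setT (bit_kl j).
Proof.
move=> jm; apply: measurable_sum => b.
have mJ : measurable_fun setT (joint_density m p snr j b).
  rewrite /joint_density; under eq_fun do rewrite -big_filter.
  apply: measurable_sum => x.
  by apply: measurable_funM => //; exact: measurable_awgn_density.
have mq : measurable_fun setT (out_density m p snr).
  apply: measurable_sum => x.
  by apply: measurable_funM => //; exact: measurable_awgn_density.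
apply: measurable_funM => //; apply: measurableT_comp => //.
apply: measurable_funM => //; apply: measurable_funV; last exact: measurable_funM.
by move=> y; rewrite mulr_ge0 ?bit_prob_ge0// ltW// out_density_gt0.
Qed.

Hypothesis s0 : 0 < snr.

(** An inequality only, because a point mass has variance 0 and is not rescaled to unit energy. *)
Lemma sum_pt_sqr : \sum_(x : qam_point m)
  sym_prob p x * ((pt p x).1 ^+ 2 + (pt p x).2 ^+ 2) <= 1 :> R.
Proof.
have -> : \sum_(x : qam_point m) sym_prob p x * ((pt p x).1 ^+ 2 + (pt p x).2 ^+ 2) =
    raw_var m p * scale m p ^+ 2.
  rewrite /raw_var mulr_suml; apply: eq_bigr => x _ /=; ring.
rewrite /scale; case: ltP => [v0|v0]; last by rewrite expr1n mulr1 (le_trans v0).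
by rewrite exprVn (sqr_sqrtr (ltW v0)) divff// gt_eqF.
Qed.

Let a : R := snr / (1 + snr).
Let a0 : 0 < a. Proof. by rewrite divr_gt0// addr_gt0. Qed.
Let s10 : 0 < 1 + snr. Proof. by rewrite addr_gt0. Qed.

(** Log-likelihood ratio at y of the channel law with input x against [gauss_out]. *)
Definition llr (x y : R * R) : R := ln (1 + snr)
  - ((y.1 - Num.sqrt snr * x.1) ^+ 2 + (y.2 - Num.sqrt snr * x.2) ^+ 2)
  + (y.1 ^+ 2 + y.2 ^+ 2) / (1 + snr).

(** Density of the centered circular Gaussian of variance 1 + snr; its factor 1 / (1 + snr) is moved
    into the exponent to fit [expq]. *)
Definition gauss_out (y : R * R) : R :=
  pi^-1 * expq (1 + snr)^-1 0 0 (- ln (1 + snr)) y.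

Lemma gauss_outE x y : gauss_out y = awgn_density snr x y * expR (- llr x y).
Proof.
rewrite /gauss_out /awgn_density /expq -mulrA -expRD /llr; congr (_ * expR _); ring.
Qed.

Lemma is_Rint_gauss_out : is_Rint gauss_out 1.
Proof.
apply: eq_is_Rint (is_RintZ pi^-1 (is_Rint_expq 0 0 (- ln (1 + snr)) _)) => //.
  rewrite invrK expr0n/= addr0 mul0r add0r expRN lnK ?posrE//.
  by rewrite mulfK ?gt_eqF// mulVf// gt_eqF// pi_gt0.
by rewrite invr_gt0.
Qed.

(* [ln (renyi K t) / t] is the Renyi divergence of order [1 + t] between the
   channel law, [K] being its squared mean, and [gauss_out]. *)
Definition renyi (K t : R) : R := (1 + a * t)^-1 *
  expR ((1 + t) ^+ 2 * K * (1 + a * t)^-1 - (1 + t) * K + t * ln (1 + snr)).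

(** The tilted exponent is quadratic in y with leading coefficient -(1 + t) + t / (1 + snr) = -(1 +
    a t), negative for every t >= 0. *)
Lemma is_Rint_tilt x t : 0 <= t ->
  is_Rint (fun y => awgn_density snr x y * expR (t * llr x y))
    (renyi (snr * (x.1 ^+ 2 + x.2 ^+ 2)) t).
Proof.
move=> t0; have A0 : 0 < 1 + a * t by rewrite ltr_pwDl// mulr_ge0// ltW.
have := is_Rint_expq (2 * (1 + t) * Num.sqrt snr * x.1)
  (2 * (1 + t) * Num.sqrt snr * x.2)
  (- (1 + t) * (snr * (x.1 ^+ 2 + x.2 ^+ 2)) + t * ln (1 + snr)) A0.
move=> /(is_RintZ pi^-1); apply: eq_is_Rint => [y|].
  rewrite /awgn_density /expq -[RHS]mulrA -expRD /llr; congr (_ * expR _).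
  have -> : snr * (x.1 ^+ 2 + x.2 ^+ 2) =
      Num.sqrt snr ^+ 2 * (x.1 ^+ 2 + x.2 ^+ 2) by rewrite sqr_sqrtr// ltW.
  by rewrite /a; field; rewrite gt_eqF.
rewrite /renyi mulrA mulKf ?gt_eqF ?pi_gt0//; congr (_ * expR _).
rewrite !exprMn (sqr_sqrtr (ltW s0)).
by field; rewrite gt_eqF.
Qed.

Lemma renyi0 K : renyi K 0 = 1.
Proof.
rewrite /renyi mulr0 addr0 invr1 (_ : _ - _ + _ = 0) ?expR0 ?mulr1//; ring.
Qed.

Lemma is_Rint_awgn_density x : is_Rint (awgn_density snr x) 1.
Proof.
apply: eq_is_Rint (is_Rint_tilt x (lexx 0)) => [y|]; last exact: renyi0.
by rewrite mul0r expR0 mulr1.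
Qed.

Let bound t y :=
  \sum_(x : qam_point m) sym_prob p x * (t^-1 *
    (awgn_density snr (pt p x) y * expR (t * llr (pt p x) y)
     - awgn_density snr (pt p x) y))
  + (gauss_out y - out_density m p snr y).

Let is_Rint_bound t : 0 < t -> is_Rint (bound t)
  (\sum_(x : qam_point m) sym_prob p x *
    (t^-1 * (renyi (snr * ((pt p x).1 ^+ 2 + (pt p x).2 ^+ 2)) t -
             renyi (snr * ((pt p x).1 ^+ 2 + (pt p x).2 ^+ 2)) 0))).
Proof.
(* The added 0 is the integral of [gauss_out] minus [out_density], two probability densities. *)
move=> t0; rewrite -[X in is_Rint _ X]addr0.
apply: is_RintD.
  apply: is_Rint_sum => x _; do 2 apply: is_RintZ; rewrite renyi0.
  apply: is_RintD; first exact/is_Rint_tilt/ltW.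
  apply: eq_is_Rint (is_RintZ (-1) (is_Rint_awgn_density (pt p x))); last by rewrite mulr1.
  by move=> y; rewrite mulN1r.
rewrite -[X in is_Rint _ X](subrr 1); apply: is_RintD; first exact: is_Rint_gauss_out.
have : is_Rint (out_density m p snr) (\sum_(x : qam_point m) sym_prob p x * 1).
  by apply: is_Rint_sum => x _; apply/is_RintZ/is_Rint_awgn_density.
move=> /(is_RintZ (-1)); apply: eq_is_Rint => [y|]; first by rewrite mulN1r.
by rewrite -mulr_suml sum_sym_prob mulr1 mulr1.
Qed.

Let sum_bit_kl_bound (t : R) y : 0 < t -> \sum_(j < m) bit_kl j y <= bound t y.
Proof.
move=> t0; apply: (sum_bit_kl_le (W := fun x => llr (pt p x) y)) => // x.
exact: gauss_outE.
Qed.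

(** Each term is at most the sum over all bits, by nonnegativity, and [bound 1] is an integrable
    majorant of that sum. *)
Lemma is_Rint_bit_kl j : (j < m)%N ->
  is_Rint (bit_kl j) (bit_mi m p snr j).
Proof.
move=> jm; apply: is_Rint_dominated (is_Rint_bound ltr01).
  exact: measurable_bit_kl.
move=> y; rewrite bit_kl_ge0//=; apply: le_trans (sum_bit_kl_bound y ltr01).
rewrite (bigD1 (Ordinal jm))//= lerDl; apply: sumr_ge0 => i _.
exact: bit_kl_ge0.
Qed.

Lemma bit_mi_ge0 j : (j < m)%N -> 0 <= bit_mi m p snr j.
Proof.
move=> jm; apply: le_is_Rint is_Rint0 (is_Rint_bit_kl jm) => y.
exact: bit_kl_ge0.
Qed.

Lemma bicm_rate_le : bicm_rate m p snr <= ln (1 + snr).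
Proof.
pose K (x : qam_point m) : R := snr * ((pt p x).1 ^+ 2 + (pt p x).2 ^+ 2).
have : bicm_rate m p snr <=
    \sum_x sym_prob p x * (ln (1 + snr) - a + K x * (1 - a)).
  apply: (le_sum_derive0_right (F := fun x => renyi (K x))) => [x|t t0].
    exact: is_derive0_renyi.
  apply: le_is_Rint (is_Rint_bound t0); first by move=> y; exact: sum_bit_kl_bound.
  by apply: is_Rint_sum => j _; exact: is_Rint_bit_kl.
move=> /le_trans; apply.
under eq_bigr do rewrite mulrDr.
rewrite big_split/= -mulr_suml sum_sym_prob mul1r.
(* As snr (1 - a) = a, the energy constraint bounds this sum by a, which cancels the term - a. *)
have -> : \sum_(x : qam_point m) sym_prob p x * (K x * (1 - a)) =
    a * \sum_(x : qam_point m) sym_prob p x * ((pt p x).1 ^+ 2 + (pt p x).2 ^+ 2).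
  rewrite mulr_sumr; apply: eq_bigr => x _; rewrite /K /a.
  by field; rewrite gt_eqF.
by have := ler_wpM2l (ltW a0) sum_pt_sqr; rewrite mulr1 -addrA gerDl; lra.
Qed.

End RateUpperBound.

(** * A polynomial upper bound on the logarithm *)

Section LogarithmBounds.
Context {R : realType}.

(** Odd degree gives an upper bound on both sides of 0. The argument will fluctuate on the scale of
    the square root of snr, so degree 5 leaves an error of order snr^3, while degree 3 would spoil
    the snr^2 coefficient. *)
Definition ln_taylor5 (x : R) : R :=
  x - x ^+ 2 / 2 + x ^+ 3 / 3 - x ^+ 4 / 4 + x ^+ 5 / 5.

Let is_derive_gap (x : R) : -1 < x ->
  is_derive x 1 (fun x : R => ln_taylor5 x - ln (1 + x)) (x ^+ 5 / (1 + x)).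
Proof.
move=> x1; have x10 : 0 < 1 + x by lra.
have i0 : is_derive x 1 (fun x : R => 1 + x) 1.
  by apply: is_derive_eq; ring.
have i1 := is_derive1_comp (is_derive1_ln x10) i0.
have i2 : is_derive x 1 ln_taylor5 (1 - x + x ^+ 2 - x ^+ 3 + x ^+ 4).
  by apply: is_derive_eq; rewrite /GRing.scale/=; field.
have /is_derive_eq i3 := is_deriveB i2 i1; apply: i3.
by field; rewrite gt_eqF.
Qed.

(** The gap vanishes at 0 and its derivative x^5 / (1 + x) has the sign of x, so 0 is its
    minimum. *)
Lemma ln1D_le_taylor5 (x : R) : -1 < x -> ln (1 + x) <= ln_taylor5 x.
Proof.
move=> x1; rewrite -subr_ge0.
set G := fun x : R => ln_taylor5 x - ln (1 + x).
have G0 : G 0 = 0 by rewrite /G /ln_taylor5 addr0 ln1; ring.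
have dG (c : R) : -1 < c -> is_derive c 1 G (c ^+ 5 / (1 + c)) by exact: is_derive_gap.
have cG (u v : R) : -1 < u -> {within `[u, v], continuous G}%classic.
  move=> u1; apply: derivable_within_continuous => c; rewrite in_itv/= => /andP[uc _].
  by have [] := dG c (lt_le_trans u1 uc).
have [x0|x0|->] := ltgtP x 0; last by rewrite -/(G 0) G0.
- have dGx c : c \in `]x, 0[ -> is_derive c 1 G (c ^+ 5 / (1 + c)).
    by rewrite in_itv/= => /andP[xc _]; apply: dG; exact: lt_trans xc.
  have [c] := MVT x0 dGx (cG x 0 x1).
  rewrite in_itv/= => /andP[xc c0]; rewrite G0 sub0r => e.
  rewrite -/(G x) -oppr_le0 e pmulr_lle0; last by rewrite sub0r oppr_gt0.
  rewrite pmulr_lle0 ?invr_gt0; last by lra.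
  by rewrite exprn_odd_le0 ?ltW.
- have dGx c : c \in `]0, x[ -> is_derive c 1 G (c ^+ 5 / (1 + c)).
    by rewrite in_itv/= => /andP[c0 _]; apply: dG; exact: lt_trans c0.
  have [c] := MVT x0 dGx (cG 0 x (ltrN10 R)).
  rewrite in_itv/= => /andP[c0 cx]; rewrite G0 subr0 => e.
  rewrite -/(G x) e mulr_ge0// ?divr_ge0 ?exprn_ge0 ?ltW//; lra.
Qed.

End LogarithmBounds.

(** * Lower bound on the rate of the corner input *)

Section CornerRate.
Context {R : realType}.

(** Moment generating function of the output given the input x; each real coordinate of the noise
    has variance 1/2. *)
Lemma is_Rint_awgn_mgf (snr : R) (x : R * R) (k1 k2 : R) :
  is_Rint (fun y => awgn_density snr x y * expR (k1 * y.1 + k2 * y.2))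
    (expR (Num.sqrt snr * (k1 * x.1 + k2 * x.2) + (k1 ^+ 2 + k2 ^+ 2) / 4)).
Proof.
set r := Num.sqrt snr.
have := is_Rint_expq (2 * r * x.1 + k1) (2 * r * x.2 + k2)
  (- (r ^+ 2 * (x.1 ^+ 2 + x.2 ^+ 2))) (@ltr01 R).
move=> /(is_RintZ pi^-1); apply: eq_is_Rint => [y|].
  rewrite /awgn_density /expq -[RHS]mulrA -expRD; congr (_ * expR _).
  by rewrite -/r; ring.
by rewrite divr1 mulKf ?gt_eqF ?pi_gt0//; congr expR; field.
Qed.

Definition taylor_coef : seq R :=
  [:: - (661 / 960); 31 / 32; - (13 / 32); 6^-1; - (3 / 64); 160^-1].

(** Expanded in powers of e because e will be a likelihood ratio, whose plain power moments are
    explicit. *)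
Lemma ln_taylor5_shift (e : R) :
  ln_taylor5 ((e - 1) / 2) = \sum_(n < 6) taylor_coef`_n * e ^+ n.
Proof. by rewrite !big_ord_recr big_ord0 /= /ln_taylor5; field. Qed.

(* Under the law of the output given [b], the [n]-th power of the likelihood ratio
   of [~~ b] against [b] has mean [w ^+ 'C(n, 2)], where [w = expR (4 * snr)]. *)
Definition bpsk_bound (w : R) : R := - \sum_(n < 6) taylor_coef`_n * w ^+ 'C(n, 2).

(** Everything is compared through polynomials in z = e^(4s) - 1, where s = ln (1 + z) / 4 is
    replaced by its polynomial majorant [sg]. *)
Lemma bpsk_bound_ge (s : R) : 0 < s -> s < 8^-1 ->
  s - s ^+ 2 / 2 - 9 * (8 * s) ^+ 3 <= 2 * bpsk_bound (expR (4 * s)).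
Proof.
move=> s0 s8; set w := expR _; pose z := w - 1.
have z0 : 0 <= z by rewrite subr_ge0 -expR0 ler_expR; lra.
(* From e^(-4s) >= 1 - 4s, which is at least 1/2 here. *)
have z8 : z <= 8 * s.
  have h : 1 - 4 * s <= w^-1 by rewrite -expRN; apply: le_trans (expR_ge1Dx _); lra.
  have w0 : 0 < w by exact: expR_gt0.
  have h1 : (1 - 4 * s) * w <= 1 by rewrite -ler_pdivlMr// div1r.
  by rewrite /z; nra.
have z1 : z <= 1 by lra.
pose sg := ln_taylor5 z / 4.
have ssg : s <= sg.
  have : 4 * s <= ln_taylor5 z.
    rewrite -{1}[4 * s]expRK -/w (_ : w = 1 + z); last by rewrite /z; ring.
    by apply: ln1D_le_taylor5; lra.
  by rewrite /sg; lra.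
have pz k : 0 <= z ^+ k <= 1 by rewrite exprn_ge0//= exprn_ile1.
have sg1 : sg <= 1.
  rewrite /sg /ln_taylor5.
  have := pz 2; have := pz 3; have := pz 4; have := pz 5.
  move=> /andP[? ?] /andP[? ?] /andP[? ?] /andP[? ?]; lra.
(* The map u - u^2 / 2 is increasing on [0, 1]. *)
have h1 : s - s ^+ 2 / 2 <= sg - sg ^+ 2 / 2 by nra.
have z3 : z ^+ 3 <= (8 * s) ^+ 3 by rewrite lerXn2r ?nnegrE//; lra.
suff h2 : sg - sg ^+ 2 / 2 - 9 * z ^+ 3 <= 2 * bpsk_bound w by lra.
(* The two sides agree through order z^2; the coefficients of the cofactor of z^3 sum to less than
   9, and z <= 1. *)
have E : 2 * bpsk_bound w = sg - sg ^+ 2 / 2 - z ^+ 3 *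
   (7/96 + 433/384 * z + 2557/960 * z ^+ 2 + 14443/5760 * z ^+ 3 +
    1451/960 * z ^+ 4 + 4273/7680 * z ^+ 5 + 41/320 * z ^+ 6 + 9/800 * z ^+ 7).
  rewrite /bpsk_bound !big_ord_recr big_ord0 /= (_ : w = 1 + z); last by rewrite /z; ring.
  by rewrite /= /sg /ln_taylor5; field.
have -> : 9 * z ^+ 3 = z ^+ 3 * 9 by ring.
rewrite E lerD2l lerN2 ler_wpM2l ?exprn_ge0//.
have := pz 2; have := pz 3; have := pz 4; have := pz 5; have := pz 6; have := pz 7.
move=> /andP[? ?] /andP[? ?] /andP[? ?] /andP[? ?] /andP[? ?] /andP[? ?]; lra.
Qed.

Variables (m : nat) (snr : R).
Hypotheses (m2 : (2 <= m)%N) (em : ~~ odd m) (s0 : 0 < snr).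

Local Notation p := (corner_prob R m).
Local Notation J := (joint_density m p snr).

Lemma corner_prob01 j : (j < m)%N -> 0 <= p j <= 1.
Proof. by rewrite /corner_prob; case: ifP => _ _; lra. Qed.

(** [E b] is the likelihood ratio of [~~ b] against [b]. For a uniform bit the posterior over the
    prior is 2 / (1 + E) = 1 / (1 + v) with v = (E - 1) / 2 >= -1/2, so an upper bound on ln (1 + v)
    bounds the information from below. *)
Lemma bpsk_bound_le_bit_mi (j : nat) (E : bool -> R * R -> R) : (j < m)%N ->
  (forall b, bit_prob p j b = 2^-1) ->
  (forall b y, J j (~~ b) y = J j b y * E b y) ->
  (forall b n, is_Rint (fun y => J j b y * E b y ^+ n)
    (2^-1 * expR (4 * snr) ^+ 'C(n, 2))) ->
  bpsk_bound (expR (4 * snr)) <= bit_mi m p snr j.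
Proof.
move=> jm pb JE intJ.
have := is_Rint_bit_kl em corner_prob01 s0 jm.
apply: (@le_is_Rint _ (fun y => \sum_(b : bool) \sum_(n < 6)
    - taylor_coef`_n * (J j b y * E b y ^+ n))); last first.
  have : is_Rint (fun y => \sum_(b : bool) \sum_(n < 6)
      - taylor_coef`_n * (J j b y * E b y ^+ n))
      (\sum_(b : bool) \sum_(n < 6)
         - taylor_coef`_n * (2^-1 * expR (4 * snr) ^+ 'C(n, 2))).
    by do 2 apply: is_Rint_sum => ? _; exact: is_RintZ.
  apply: eq_is_Rint => //; rewrite big_bool -big_split /bpsk_bound -sumrN.
  by apply: eq_bigr => n _ /=; field.
move=> y; apply: ler_sum => b _; rewrite pb.
have J0 c : 0 <= J j c y by exact: joint_density_ge0 corner_prob01 _ _ _.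
have qE : out_density m p snr y = J j b y * (1 + E b y).
  rewrite -(joint_density_sum m p snr j) big_bool mulrDr mulr1 -JE.
  by case: b; rewrite //= addrC.
have q0 : 0 < out_density m p snr y by exact: out_density_gt0 corner_prob01 _.
have Jb : 0 < J j b y.
  by rewrite lt_neqAle J0 andbT; apply: contraTneq q0 => e; rewrite qE -e mul0r ltxx.
have Eb : 0 <= E b y by have := J0 (~~ b); rewrite JE pmulr_rge0.
have -> : J j b y / (2^-1 * out_density m p snr y) = (1 + (E b y - 1) / 2)^-1.
  by rewrite qE; field; rewrite !gt_eqF//; lra.
rewrite lnV ?posrE; last by lra.
have -> : \sum_(n < 6) - taylor_coef`_n * (J j b y * E b y ^+ n) =
    - (J j b y * ln_taylor5 ((E b y - 1) / 2)).
  by rewrite ln_taylor5_shift mulr_sumr -sumrN; apply: eq_bigr => n _; ring.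
by rewrite mulrN lerN2 ler_wpM2l// ln1D_le_taylor5//; lra.
Qed.

Let a : R := Num.sqrt snr / Num.sqrt 2.
Let a2 : a ^+ 2 = snr / 2.
Proof. by rewrite /a expr_div_n !sqr_sqrtr// ltW. Qed.

Local Notation F b1 b2 := (awgn_density snr (pt p (qam_corner m b1 b2))).

Lemma awgn_density_corner b1 b2 y : F b1 b2 y =
  pi^-1 * expR (- ((y.1 - bsign R b1 * a) ^+ 2 + (y.2 - bsign R b2 * a) ^+ 2)).
Proof. by rewrite pt_corner// /awgn_density /= /a ![Num.sqrt snr * _]mulrCA. Qed.

Lemma joint_density_corner j b y : J j b y = 4^-1 * \sum_(b1 : bool) \sum_(b2 : bool)
  (if qam_bit (qam_corner m b1 b2) j == b then F b1 b2 y else 0).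
Proof.
rewrite -(sum_sym_prob_corner m2 em (fun x => if qam_bit x j == b
  then awgn_density snr (pt p x) y else 0)) /joint_density big_mkcond.
by apply: eq_bigr => x _; case: ifP; rewrite ?mulr0.
Qed.

Lemma joint_density_corner0 b y : J 0 b y = 4^-1 * (F b true y + F b false y).
Proof.
rewrite joint_density_corner !big_bool !qam_bit_corner0//.
by case: b; rewrite /= ?addr0 ?add0r.
Qed.

Lemma joint_density_corner_half b y :
  J m./2 b y = 4^-1 * (F true b y + F false b y).
Proof.
rewrite joint_density_corner !big_bool !qam_bit_corner_half//.
by case: b; rewrite /= ?addr0 ?add0r.
Qed.

Lemma expR_bin2 n : expR (2 * snr * (n%:R ^+ 2 - n%:R)) = expR (4 * snr) ^+ 'C(n, 2).
Proof.
rewrite -expRM_natl; congr expR.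
have -> : n%:R ^+ 2 - n%:R = 'C(n, 2)%:R * 2 :> R; last by ring.
elim: n => [|n ih]; first by rewrite bin0n mul0r expr0n subrr.
by rewrite binS bin1 natrD mulrDl -ih -natr1; ring.
Qed.

Lemma bsignM b : bsign R b * bsign R b = 1.
Proof. by rewrite /bsign; case: b; ring. Qed.

Lemma bpsk_bound_le_bit_mi0 : bpsk_bound (expR (4 * snr)) <= bit_mi m p snr 0.
Proof.
(* With s = [bsign R b], the log-likelihood ratio is (y.1 - s a)^2 - (y.1 + s a)^2 = - 4 s a y.1. *)
pose k b : R := - (4 * bsign R b * a).
apply: (@bpsk_bound_le_bit_mi 0 (fun b y => expR (k b * y.1))) => [|b|b y|b n].
- exact: leq_trans m2.
- by rewrite /bit_prob /corner_prob eqxx; case: b => /=; lra.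
- rewrite !joint_density_corner0 -mulrA mulrDl; congr (_ * (_ + _));
  rewrite !awgn_density_corner -mulrA -expRD; congr (_ * expR _);
  by rewrite /k /bsign; case: b => /=; ring.
- have int c : is_Rint (fun y => F b c y * expR (k b * y.1) ^+ n)
      (expR (4 * snr) ^+ 'C(n, 2)).
    have := is_Rint_awgn_mgf snr (pt p (qam_corner m b c)) (n%:R * k b) 0.
    apply: eq_is_Rint => [y|].
      by rewrite mul0r addr0 -mulrA expRM_natl.
    rewrite -expR_bin2 pt_corner//=; congr expR; rewrite mul0r addr0 expr0n/= addr0.
    have -> : Num.sqrt snr * (n%:R * k b * (bsign R b / Num.sqrt 2)) =
        n%:R * k b * bsign R b * a by rewrite /a; ring.
    have -> : n%:R * k b * bsign R b * a + (n%:R * k b) ^+ 2 / 4 =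
        (bsign R b * bsign R b) * a ^+ 2 * 4 * (n%:R ^+ 2 - n%:R).
      by rewrite /k; field.
    by rewrite bsignM a2; field.
  have := is_RintZ 4^-1 (is_RintD (int true) (int false)).
  by apply: eq_is_Rint => [y|]; rewrite ?joint_density_corner0; field.
Qed.

Lemma bpsk_bound_le_bit_mi_half :
  bpsk_bound (expR (4 * snr)) <= bit_mi m p snr m./2.
Proof.
(* The same log-likelihood ratio, now in the quadrature coordinate. *)
pose k b : R := - (4 * bsign R b * a).
apply: (@bpsk_bound_le_bit_mi m./2 (fun b y => expR (k b * y.2))) => [|b|b y|b n].
- by rewrite ltn_half_double -addnn -[ltnLHS]addn0 ltn_add2l (leq_trans _ m2).
- by rewrite /bit_prob /corner_prob eqxx orbT; case: b => /=; lra.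
- rewrite !joint_density_corner_half -mulrA mulrDl; congr (_ * (_ + _));
  rewrite !awgn_density_corner -mulrA -expRD; congr (_ * expR _);
  by rewrite /k /bsign; case: b => /=; ring.
- have int c : is_Rint (fun y => F c b y * expR (k b * y.2) ^+ n)
      (expR (4 * snr) ^+ 'C(n, 2)).
    have := is_Rint_awgn_mgf snr (pt p (qam_corner m c b)) 0 (n%:R * k b).
    apply: eq_is_Rint => [y|].
      by rewrite mul0r add0r -mulrA expRM_natl.
    rewrite -expR_bin2 pt_corner//=; congr expR; rewrite mul0r add0r expr0n/= add0r.
    have -> : Num.sqrt snr * (n%:R * k b * (bsign R b / Num.sqrt 2)) =
        n%:R * k b * bsign R b * a by rewrite /a; ring.
    have -> : n%:R * k b * bsign R b * a + (n%:R * k b) ^+ 2 / 4 =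
        (bsign R b * bsign R b) * a ^+ 2 * 4 * (n%:R ^+ 2 - n%:R).
      by rewrite /k; field.
    by rewrite bsignM a2; field.
  have := is_RintZ 4^-1 (is_RintD (int true) (int false)).
  by apply: eq_is_Rint => [y|]; rewrite ?joint_density_corner_half; field.
Qed.

(** The two random bits contribute one BPSK bound each; for the remaining bits nonnegativity
    suffices. *)
Lemma bicm_rate_corner_ge : 2 * bpsk_bound (expR (4 * snr)) <= bicm_rate m p snr.
Proof.
have k0 : (0 < m./2)%N by rewrite half_gt0.
have m0 : (0 < m)%N by exact: leq_trans m2.
have km : (m./2 < m)%N by rewrite ltn_half_double -addnn -[ltnLHS]addn0 ltn_add2l.
rewrite /bicm_rate (bigD1 (Ordinal m0))//= (bigD1 (Ordinal km))/=; last first.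
  by rewrite -val_eqE/= -lt0n.
have := bpsk_bound_le_bit_mi0; have := bpsk_bound_le_bit_mi_half.
have : 0 <= \sum_(i < m | (i != Ordinal m0) && (i != Ordinal km)) bit_mi m p snr i.
  by apply: sumr_ge0 => i _; exact: bit_mi_ge0 corner_prob01 _ _ _.
lra.
Qed.

End CornerRate.

(** * The second-order expansion from the two bounds *)

Unset Implicit Arguments.

(* C_bicm(snr) = snr - snr^2/2 + o(snr^2) as snr -> 0+ *)
Theorem theorem2 (R : realType) (m : nat) (hm2 : (2 <= m)%N) (hmeven : ~~ odd m) :
  forall eps : R, 0 < eps -> exists delta : R, 0 < delta /\
    forall snr : R, 0 < snr -> snr < delta ->
      `| C_bicm m snr - (1 * snr + (- 1 / 2) * snr ^+ 2) | <= eps * snr ^+ 2.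
Proof.
move=> eps eps0.
(* C is the constant of the cubic error in the lower bound; being at least 1, it also covers the
   cubic error 1/3 + 1/5 of the upper one. *)
have [C C1 CE] : exists2 C : R, 1 <= C & forall s, 9 * (8 * s) ^+ 3 = C * s ^+ 3.
  by exists (9 * 8 ^+ 3) => [|s]; [lra | rewrite exprMn mulrA].
have C0 : 0 < C by exact: lt_le_trans C1.
(* The first term is the range of [bpsk_bound_ge]; the second turns C snr^3 into at most eps
   snr^2. *)
exists (Num.min 8^-1 (eps / C)); split.
  by rewrite lt_min invr_gt0 divr_gt0// ltr0n.
move=> snr s0; rewrite lt_min => /andP[s8 seps].
have sC : C * snr ^+ 3 <= eps * snr ^+ 2.
  by rewrite exprS mulrA ler_wpM2r ?sqr_ge0// mulrC -ler_pdivlMr// ltW.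
set S := [set r : R | exists p : nat -> R,
  (forall j, (j < m)%N -> 0 <= p j <= 1) /\ r = bicm_rate m p snr]%classic.
have ubS : ubound S (ln (1 + snr)).
  by move=> _ [p [p01 ->]]; exact: bicm_rate_le.
have Sc : S (bicm_rate m (corner_prob R m) snr).
  by exists (corner_prob R m); split => // j; exact: corner_prob01.
have up : C_bicm m snr <= ln (1 + snr) by apply: ge_sup => //; exists (bicm_rate m (corner_prob R m) snr).
have lo : bicm_rate m (corner_prob R m) snr <= C_bicm m snr.
  by apply: ub_le_sup => //; exists (ln (1 + snr)).
have corner := bicm_rate_corner_ge hm2 hmeven s0.
have := bpsk_bound_ge s0 s8; rewrite CE => bpsk.
have lnT : ln (1 + snr) <= ln_taylor5 snr by apply: ln1D_le_taylor5; lra.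
have s3 : 0 <= snr ^+ 3 by rewrite exprn_ge0// ltW.
have T : ln_taylor5 snr <= snr - snr ^+ 2 / 2 + C * snr ^+ 3.
  have s4 : 0 <= snr ^+ 4 by rewrite exprn_ge0// ltW.
  have s5 : snr ^+ 5 <= snr ^+ 3 by rewrite ler_wiXn2l//; lra.
  have Cs : snr ^+ 3 <= C * snr ^+ 3 by rewrite ler_peMl.
  by rewrite /ln_taylor5; lra.
by rewrite ler_norml; apply/andP; split; lra.
Qed.
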